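(* There is an absolute constant $C>0$ such that the following holds. Let $D_1$ be a deck of cards with $h$ different labels with each label occurring $n_0$ times, where $h, n_0\ge 1$. Let $D_2$ be another deck with the same $n=hn_0$ cards in a different order. Let $\pi$ be a uniformly distributed random permutation in $\Pi(D_1;D_2)$, let $W=\operatorname{des}(\pi)$ be the number of descents of $\pi$, and let $\mu=\mathrm{E}\,W$ and $\sigma^2=\mathrm{Var}(W)$. Assume $\sigma>7^{2/3}(6\mu)^{1/3}$. Then for all real $x$, $$\left|\mathrm{P}\left(\frac{W-\mu}{\sigma}\le x\right)-\Phi(x)\right|\le C\left(\frac1\sigma+\frac{\mu}{\sigma^3}+\frac{\mu}{\sigma^4}+\frac{\sqrt n}{\sigma^2}\right),$$ where $\Phi(x)=\frac{1}{\sqrt{2\pi}}\int_{-\infty}^x\exp(-u^2/2)\,du$.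
   Context: A deck is a finite ordered sequence of labeled cards (labels may repeat); $D(i)$ denotes the label of the card in position $i$ of $D$. For decks $D_1,D_2$ of $n$ cards in which each label occurs equally often, $\Pi(D_1;D_2)$ is the set of permutations $\pi$ of $\{1,\ldots,n\}$ with $D_1(i)=D_2(\pi(i))$ for all $1\le i\le n$. The number of descents $\operatorname{des}(\pi)$ is the number of $i$ with $1\le i\le n-1$ and $\pi(i)>\pi(i+1)$. In the definition of $\Phi$, $\pi$ denotes the number $3.14159\ldots$. *)

(* Defs.v *)
From mathcomp Require Import all_boot all_order all_algebra all_fingroup.
From mathcomp Require Import all_classical all_reals all_analysis.
Set Implicit Arguments.
Unset Strict Implicit.
Unset Printing Implicit Defensive.
Import Order.TTheory GRing.Theory Num.Theory.
Local Open Scope ring_scope.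

Definition deck_perms (L : eqType) (n : nat) (D1 D2 : n.-tuple L) : {set 'S_n} :=
  [set s : 'S_n | [forall i : 'I_n, tnth D1 i == tnth D2 (s i)]].

Definition des (n : nat) (s : 'S_n) : nat :=
  #|[set i : 'I_n | [exists j : 'I_n, (j == i.+1 :> nat) && (s j < s i)%N]]|.

(* In the next three definitions the random element is uniformly distributed
   on the finite set A, which is assumed to be nonempty. *)
Definition unif_pr (R : realType) (T : finType) (A : {set T}) (E : pred T) : R :=
  #|[set t in A | E t]|%:R / #|A|%:R.

Definition unif_mean (R : realType) (T : finType) (A : {set T}) (f : T -> R) : R :=
  (\sum_(t in A) f t) / #|A|%:R.

Definition unif_var (R : realType) (T : finType) (A : {set T}) (f : T -> R) : R :=
  unif_mean A (fun t => (f t - unif_mean A f) ^+ 2).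

Definition std_normal_cdf (R : realType) (x : R) : R :=
  (Num.sqrt (2 * pi))^-1 *
  \int[@lebesgue_measure R]_(u in [set` `]-oo, x]]) expR (- (u ^+ 2) / 2).

(* Main.v *)
Require Import Defs.
From mathcomp Require Import all_boot all_order all_algebra all_fingroup.
From mathcomp Require Import all_classical all_reals all_analysis.
From mathcomp Require Import measurable_realfun ring lra.
Import Order.TTheory GRing.Theory Num.Theory.
Import numFieldNormedType.Exports.
Local Open Scope ring_scope.

(** The proof is Stein's method with a size-biased coupling.

    Write [W] as the sum over the pairs of consecutive positions of the
    indicators of a descent there.  Draw such a pair [e] and a second permutation
    [t], with weight 1 if [t] has a descent at [e] and 0 otherwise, and swap
    values of [s] until [s] agrees with [t] at both ends of [e] ([impose]).  The
    swaps turn the uniform distribution into the uniform distribution on the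
    permutations with these two prescribed values ([sum_impose]), so summing
    over [e] and [t] gives [mu * E f(W^s) = E (W * f W)] for every [f]
    ([impose_size_bias]), and [W^s] differs from [W] by at most 8.

    For such a bounded coupling, Stein's equation for a smoothed indicator bounds
    the Kolmogorov distance [d] to the normal distribution by
    [eps + d / 4] ([self_improvement]), hence by a multiple of [eps]
    ([size_bias_kolmogorov_bound]), where [eps] is of the order of
    [sigma^-1 + mu / sigma ^+ 3 + Num.sqrt v / sigma ^+ 2] and [v] is the
    variance of the conditional mean [Y] of [mu * (W^s - W)] given [s].
    The Gaussian ingredients are Mills' inequality and the bounds on the solution
    of Stein's equation that follow from it ([stein_equation]).

    It remains to see that [v] is at most a constant times [n].  The swap of two
    values is a local operation: it interferes with [impose e t] only if one of
    the positions or values involved is adjacent to one of the swapped values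
    ([impose_local]), which happens for a bounded part of the total weight.
    Hence the swap of two equally labelled values changes [Y] by a bounded amount
    ([mean_shift_tperm]).  Revealing the values of the permutation one position
    at a time, each step then adds a bounded amount to the variance
    ([deck_unif_var_le]). *)

(** * The Gaussian weight and Stein's equation *)

Section GaussWeight.
Variable R : realType.
Implicit Types (x w : R) (g : R -> R).

Definition gauss_weight (u : R) : R := expR (- (u ^+ 2) / 2).

Local Notation leb := (@lebesgue_measure R).
Local Notation gw := gauss_weight.

Lemma gauss_weight_gt0 x : 0 < gw x. Proof. exact: expR_gt0. Qed.
Lemma gauss_weight_ge0 x : 0 <= gw x. Proof. exact: expR_ge0. Qed.

Lemma gauss_weightN x : gw (- x) = gw x.
Proof. by rewrite /gw sqrrN. Qed.

Lemma gauss_weight_le1 x : gw x <= 1.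
Proof. by rewrite -expR0 ler_expR mulNr oppr_le0 divr_ge0 ?sqr_ge0. Qed.

Lemma gauss_weight_normal :
  gw = (fun x => Num.sqrt (2 * pi) * normal_pdf 0 1 x).
Proof.
apply/funext => x; rewrite /normal_pdf oner_eq0 /normal_peak /normal_fun.
rewrite subr0 expr1n mul1r -[pi *+ 2]mulr_natl mulrA divff ?mul1r //.
by rewrite gt_eqF// sqrtr_gt0 mulr_gt0 ?pi_gt0.
Qed.

Lemma is_derive_gauss_weight x : is_derive x 1 gw (- x * gw x).
Proof.
have h (y : R) : is_derive y 1 (fun u : R => - (u ^+ 2) / 2) (- y).
  by apply: is_derive_eq; rewrite /GRing.scale /=; field.
have := @is_derive1_comp R expR _ x _ _ (is_derive_expR (- (x ^+ 2) / 2)) (h x).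
by rewrite mulrC.
Qed.

Lemma continuous_gauss_weight : continuous gw.
Proof.
move=> x; apply: differentiable_continuous; apply/derivable1_diffP.
by have [] := is_derive_gauss_weight x.
Qed.

Lemma integrable_gauss_weight : leb.-integrable setT (EFin \o gw).
Proof.
rewrite gauss_weight_normal.
have := integrableZl (measurableT) (Num.sqrt (2 * pi)) (integrable_normal_pdf (0:R) 1).
by apply.
Qed.

Lemma Rintegral_gauss_weight :
  \int[leb]_(x in setT) gw x = Num.sqrt (2 * pi).
Proof.
rewrite gauss_weight_normal RintegralZl//; last exact: integrable_normal_pdf.
by rewrite /Rintegral integral_normal_pdf /= mulr1.
Qed.

Lemma sqrt_2pi_gt0 : 0 < Num.sqrt (2 * pi) :> R.
Proof. by rewrite sqrtr_gt0 mulr_gt0 ?pi_gt0. Qed.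

Lemma cvg_gauss_weight : (gw x @[x --> +oo] --> (0 : R))%classic.
Proof.
have -> : gw = (fun x => expR (- (x ^+ 2 / 2))).
  by apply/funext => x; rewrite /gw mulNr.
apply: (cvg_comp (fun x : R => x ^+ 2 / 2) (fun x => expR (- x))).
  apply: gt0_cvgMly; [by [] | exact: cvgr_expr2].
exact: cvgr_expR.
Qed.

(** Mills' inequality: to the right of [w] the weight at [x] is at most
    [x / w] times itself, and [x * gauss_weight x] has the antiderivative
    [- gauss_weight x]. *)
Lemma Rintegral_gauss_tail w : 0 < w ->
  \int[leb]_(x in `[w, +oo[%classic) gw x <= gw w / w.
Proof.
move=> w0; rewrite ler_pdivlMr// mulrC.
have mI : measurable (`[w, +oo[%classic : set R) by [].
have iw : leb.-integrable `[w, +oo[%classic (EFin \o gw).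
  by apply: integrableS integrable_gauss_weight.
have cf : continuous (fun x => x * gw x).
  by move=> x; apply: cvgM; [exact: cvg_id|exact: continuous_gauss_weight].
have dN (x : R) : is_derive x 1 (fun y => - gw y) (x * gw x).
  have := is_deriveN (is_derive_gauss_weight x).
  by rewrite mulNr opprK.
have ei := @ge0_continuous_FTC2y R (fun x => x * gw x) (fun x => - gw x) w 0.
have {}ei : (\int[leb]_(x in `[w, +oo[%classic) (x * gw x)%:E = (gw w)%:E)%E.
  rewrite ei ?sub0r ?opprK -?EFinB ?sub0r ?opprK //.
  - by move=> x wx; rewrite mulr_ge0 ?gauss_weight_ge0// (le_trans _ wx)// ltW.
  - by apply: continuous_subspaceT; exact: cf.
  - by rewrite -oppr0; apply: cvgN; exact: cvg_gauss_weight.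
  - apply: cvgN; apply: cvg_at_right_filter; exact: continuous_gauss_weight.
  - by move=> x _; rewrite derive1E; have [_ ->] := dN x.
have ix : leb.-integrable `[w, +oo[%classic (EFin \o (fun x => x * gw x)).
  apply/integrableP; split.
    apply/measurable_EFinP; apply: measurable_funTS.
    exact: continuous_measurable_fun.
  apply/abse_integralP => //; last by rewrite /= ei ltry.
  by apply/measurable_EFinP; apply: measurable_funTS; exact: continuous_measurable_fun.
rewrite -RintegralZl//.
apply: (@le_trans _ _ (\int[leb]_(x in `[w, +oo[%classic) (x * gw x))); last first.
  by rewrite /Rintegral ei.
apply: le_Rintegral => //.
  by have := integrableZl _ w iw; apply.
move=> x; rewrite /= in_itv /= andbT => wx.
by rewrite ler_wpM2r ?gauss_weight_ge0.
Qed.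

Lemma Rintegral_gauss_tailN w :
  \int[leb]_(x in `]-oo, (- w)]%classic) gw x =
  \int[leb]_(x in `[w, +oo[%classic) gw x.
Proof.
rewrite /Rintegral ge0_integration_by_substitutionNy.
- by congr fine; apply: eq_integral => x _ /=; rewrite gauss_weightN.
- by apply: continuous_subspaceT; exact: continuous_gauss_weight.
- by move=> x _; exact: gauss_weight_ge0.
Qed.


Lemma sqrt_2pi_le3 : Num.sqrt (2 * pi) <= 3 :> R.
Proof.
have -> : 3 = Num.sqrt (3 ^+ 2) :> R by rewrite sqrtr_sqr ger0_norm.
apply: ler_wsqrtr; have := @pihalf_02 R; lra.
Qed.

Section SteinEquation.
Variable g : R -> R.
Hypothesis g_cont : continuous g.
Hypothesis g_le1 : forall x, `|g x| <= 1.
Hypothesis g_centred : \int[leb]_(x in setT) (g x * gw x) = 0.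

Let gp := fun x => g x * gw x.
Let G w := \int[leb]_(x in `]-oo, w]%classic) gp x.

Let gp_cont : continuous gp.
Proof.
by move=> x; apply: cvgM; [exact: g_cont|exact: continuous_gauss_weight].
Qed.

Let gp_le x : `|gp x| <= gw x.
Proof.
rewrite normrM (ger0_norm (gauss_weight_ge0 x)).
by rewrite ler_piMl ?gauss_weight_ge0.
Qed.

Let gp_int : leb.-integrable setT (EFin \o gp).
Proof.
apply: (le_integrable _ _ _ integrable_gauss_weight) => //.
  by apply/measurable_EFinP; exact: continuous_measurable_fun.
move=> x _ /=; rewrite lee_fin (le_trans (gp_le x))//.
exact: ler_norm.
Qed.

Let gp_norm_le (A : set R) : measurable A ->
  `|\int[leb]_(x in A) gp x| <= \int[leb]_(x in A) gw x.
Proof.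
move=> mA.
have ip : leb.-integrable A (EFin \o gp) by apply: integrableS gp_int.
have ig : leb.-integrable A (EFin \o gw).
  by apply: integrableS integrable_gauss_weight.
apply: (le_trans (le_normr_Rintegral _ _)) => //.
apply: le_Rintegral => //.
by have := integrable_abse ip; apply.
Qed.

Let G_upper w : G w = - \int[leb]_(x in `[w, +oo[%classic) gp x.
Proof.
have := @Rintegral_itvB R gp -oo%O +oo%O w.
rewrite set_itvNyy => /(_ gp_int erefl erefl).
rewrite g_centred sub0r Rintegral_itv_obnd_cbnd; last first.
  by apply: integrableS gp_int.
by move=> <-; rewrite opprK.
Qed.

Let G_mul w : `|w * G w| <= gw w.
Proof.
rewrite normrM; have [w0|w0|->] := ltrgt0P w.
- rewrite G_upper normrN -ler_pdivlMl// mulrC.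
  have mI : measurable (`[w, +oo[%classic : set R) by [].
  exact: le_trans (gp_norm_le _ mI) (Rintegral_gauss_tail _ w0).
- have w0' : 0 < - w by rewrite oppr_gt0.
  rewrite -ler_pdivlMl// mulrC -(gauss_weightN w).
  apply: le_trans (Rintegral_gauss_tail _ w0').
  have mI : measurable (`]-oo, w]%classic : set R) by [].
  by rewrite -Rintegral_gauss_tailN opprK; exact: gp_norm_le _ mI.
- by rewrite mul0r gauss_weight_ge0.
Qed.

Let G_le3 w : `|G w| <= 3.
Proof.
have mI : measurable (`]-oo, w]%classic : set R) by [].
apply: (le_trans (gp_norm_le _ mI)); apply: (le_trans _ sqrt_2pi_le3).
rewrite -Rintegral_gauss_weight.
have := @Rintegral_itvB R gw -oo%O +oo%O w.
rewrite set_itvNyy => /(_ integrable_gauss_weight erefl erefl) h.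
rewrite -subr_ge0 h; apply: Rintegral_ge0 => x _; exact: gauss_weight_ge0.
Qed.

Let is_derive_G (w : R) : is_derive w 1 G (gp w).
Proof.
have := @continuous_FTC1 R gp -oo%O w (w + 1) _ _ (ltNyr w) (gp_cont w).
rewrite ltrDl => /(_ ltr01) h.
have [|h1 h2] := h; first by apply: integrableS gp_int.
by split => //; rewrite -derive1E.
Qed.

(** Stein's equation [f' w - w * f w = g w]: the solution is [G / gauss_weight],
    where [G] is the primitive of [g * gauss_weight] that vanishes at [-oo].
    As [g] is centred, [G] also vanishes at [+oo], so that [G w] is bounded by
    either Gaussian tail, and Mills' inequality gives the bound on [w * f w].
    This also bounds [f w] for [1 < `|w|]; elsewhere the crude bounds
    [`|G w| <= 3] and [1 / 2 <= gauss_weight w] suffice. *)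
Lemma stein_equation : exists f : R -> R, [/\
  forall w : R, is_derive w 1 f (w * f w + g w),
  forall w, `|f w| <= 6 & forall w, `|w * f w| <= 1].
Proof.
have gwn w : gw w != 0 by rewrite gt_eqF ?gauss_weight_gt0.
exists (fun w => G w * (gw w)^-1); split => w.
- have h1 := is_derive_G w; have h2 := is_derive_gauss_weight w.
  have h3 := is_deriveV (gwn w) h2.
  apply: (is_derive_eq (is_deriveM h1 h3)).
  rewrite /GRing.scale /= /gp -/(gw w); field.
  by rewrite gwn.
- have g0 := gauss_weight_gt0 w.
  rewrite normrM normfV (ger0_norm (ltW g0)) ler_pdivrMr//.
  have [w1|w1] := leP `|w| 1.
    apply: (le_trans (G_le3 w)).
    suff : 1 / 2 <= gw w by lra.
    apply: (le_trans _ (expR_ge1Dx _)).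
    suff : w ^+ 2 <= 1 by lra.
    by rewrite -(real_normK (num_real w)) expr_le1.
  have := G_mul w; rewrite normrM => h.
  have : `|G w| <= `|w| * `|G w| by rewrite ler_peMl// ltW.
  lra.
- have g0 := gauss_weight_gt0 w.
  rewrite mulrA normrM normfV (ger0_norm (ltW g0)) ler_pdivrMr// mul1r.
  exact: G_mul.
Qed.
End SteinEquation.

End GaussWeight.

(** * The normal distribution function and smoothed indicators *)

Section SmoothedIndicator.
Variable R : realType.
Implicit Types (x y z a : R).
Local Notation leb := (@lebesgue_measure R).
Local Notation gw := (@gauss_weight R).
Local Notation Phi := (@std_normal_cdf R).

(** The continuous approximation of the indicator of [x <= z]: it is affine
    between the value 1 at [z] and the value 0 at [z + a]. *)
Definition ramp (z a x : R) : R := Num.max 0 (Num.min 1 ((z + a - x) / a)).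

Lemma ramp_ge0 z a x : 0 <= ramp z a x.
Proof. by rewrite /ramp le_max lexx. Qed.

Lemma ramp_le1 z a x : ramp z a x <= 1.
Proof. by rewrite /ramp ge_max ler01 ge_min lexx. Qed.

Lemma ramp_left z a x : 0 < a -> x <= z -> ramp z a x = 1.
Proof.
move=> a0 xz; rewrite /ramp min_l ?max_r ?ler01//.
by rewrite ler_pdivlMr// mul1r; lra.
Qed.

Lemma ramp_right z a x : 0 < a -> z + a <= x -> ramp z a x = 0.
Proof.
move=> a0 xz; rewrite /ramp max_l// ge_min; apply/orP; right.
by rewrite ler_pdivrMr// mul0r; lra.
Qed.

Lemma ramp_lip z a x y : 0 < a -> `|ramp z a x - ramp z a y| <= `|x - y| / a.
Proof.
move=> a0.
have -> : `|x - y| / a = `|(z + a - x) / a - (z + a - y) / a|.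
  rewrite -mulrBl normrM normfV (gtr0_norm a0) distrC; congr (`|_| / _); ring.
rewrite /ramp; move: ((z + a - x) / a) ((z + a - y) / a) => u v.
have := ler_norm (u - v); have := ler_norm (v - u); rewrite [`|v - u|]distrC.
rewrite !maxEle !minEle ler_norml => h1 h2; apply/andP.
case: (lerP 1 u) => ?; case: (lerP 1 v) => ?; rewrite ?ler01;
by case: (lerP 0 u) => ?; case: (lerP 0 v) => ?; split; lra.
Qed.

Lemma continuous_ramp z a : continuous (ramp z a).
Proof.
have lin : continuous (fun x => (z + a - x) / a : R^o).
  move=> x; apply: cvgM; last exact: cvg_cst.
  by apply: cvgB; [exact: cvg_cst|exact: cvg_id].
move=> x.
apply: (@continuous_max _ _ (fun=> 0 : R^o)
  (fun x => Num.min 1 ((z + a - x) / a)) x); first exact: cvg_cst.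
apply: (@continuous_min _ _ (fun=> 1 : R^o)) (lin x).
exact: cvg_cst.
Qed.

Lemma integrable_ramp z a (A : set R) : measurable A ->
  leb.-integrable A (EFin \o (fun x => ramp z a x * gw x)).
Proof.
move=> mA; have mT : measurable (setT : set R) by [].
apply: (@integrableS _ _ _ _ setT) => //.
apply: (le_integrable _ _ _ (integrable_gauss_weight R)) => //.
  apply/measurable_EFinP; apply: continuous_measurable_fun => x.
  by apply: cvgM; [exact: continuous_ramp|exact: continuous_gauss_weight].
move=> x _ /=; rewrite lee_fin !ger0_norm ?mulr_ge0 ?ramp_ge0 ?gauss_weight_ge0//.
by rewrite ler_piMl ?gauss_weight_ge0 ?ramp_le1.
Qed.

Definition ramp_mean z a : R :=
  (Num.sqrt (2 * pi))^-1 * \int[leb]_(x in setT) (ramp z a x * gw x).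

Let integrable_gw (A : set R) : measurable A -> leb.-integrable A (EFin \o gw).
Proof. by move=> mA; apply: integrableS (integrable_gauss_weight R). Qed.

Let c0 : 0 <= (Num.sqrt (2 * pi))^-1 :> R.
Proof. by rewrite invr_ge0 ltW ?sqrt_2pi_gt0. Qed.

Let intB (f : R -> R) z : leb.-integrable setT (EFin \o f) ->
  \int[leb]_(x in setT) f x =
  \int[leb]_(x in `]-oo, z]%classic) f x + \int[leb]_(x in `]z, +oo[%classic) f x.
Proof.
move=> fi; have := @Rintegral_itvB R f -oo%O +oo%O z.
by rewrite set_itvNyy => /(_ fi erefl erefl) <-; rewrite addrC subrK.
Qed.

Lemma std_normal_cdf_le_ramp_mean z a : 0 < a -> Phi z <= ramp_mean z a.
Proof.
move=> a0; rewrite /std_normal_cdf /ramp_mean ler_wpM2l//.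
rewrite (intB _ z); last exact: integrable_ramp.
rewrite ler_wpDr//.
  by apply: Rintegral_ge0 => x _; rewrite mulr_ge0 ?ramp_ge0 ?gauss_weight_ge0.
apply: le_Rintegral => //; first exact: integrable_gw.
  exact: integrable_ramp.
by move=> x; rewrite /= in_itv /= => xz; rewrite ramp_left// mul1r.
Qed.

Lemma ramp_mean_le_std_normal_cdf z a : 0 < a -> ramp_mean z a <= Phi (z + a).
Proof.
move=> a0; rewrite /std_normal_cdf /ramp_mean ler_wpM2l//.
rewrite (intB _ (z + a)); last exact: integrable_ramp.
rewrite [X in _ + X](_ : _ = 0) ?addr0.
  apply: le_Rintegral => //; first exact: integrable_ramp.
    exact: integrable_gw.
  by move=> x _; rewrite ler_piMl ?gauss_weight_ge0 ?ramp_le1.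
rewrite -[RHS](Rintegral_set0 leb (fun _ => 0)).
rewrite [RHS](_ : _ = \int[leb]_(x in `]z + a, +oo[%classic) (0 * gw x)).
  apply: eq_Rintegral => x; rewrite inE /= in_itv /= andbT => /ltW xz.
  by rewrite ramp_right.
rewrite RintegralZl ?mul0r ?Rintegral_set0//; exact: integrable_gw.
Qed.

Lemma std_normal_cdf_ge0 z : 0 <= Phi z.
Proof.
by rewrite mulr_ge0//; apply: Rintegral_ge0 => x _; exact: gauss_weight_ge0.
Qed.

Lemma std_normal_cdf_le1 z : Phi z <= 1.
Proof.
rewrite -(@mulVf _ (Num.sqrt (2 * pi) : R)) ?gt_eqF ?sqrt_2pi_gt0//.
rewrite ler_wpM2l// -Rintegral_gauss_weight (intB _ z); last exact: integrable_gw.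
by rewrite lerDl; apply: Rintegral_ge0 => x _; exact: gauss_weight_ge0.
Qed.

Lemma std_normal_cdf_lip x y : x <= y -> Phi y <= Phi x + (y - x).
Proof.
move=> xy; rewrite -lerBlDl /std_normal_cdf -mulrBr.
have mI : measurable (`]-oo, y]%classic : set R) by [].
have := @Rintegral_itvB R gw -oo%O (BRight y) x (integrable_gw _ mI).
rewrite bnd_simp => /(_ isT xy) ->.
have m2 : measurable (`]x, y]%classic : set R) by [].
have h : \int[leb]_(t in `]x, y]%classic) gw t <= y - x.
  have -> : y - x = \int[leb]_(t in `]x, y]%classic) (1 : R).
    rewrite Rintegral_cst// mul1r /= lebesgue_measure_itv /= lte_fin.
    by have [_|yx] := ltP x y; rewrite ?oppr0 /= ?subrr //; lra.
  apply: le_Rintegral => //; first exact: integrable_gw.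
    apply/integrableP; split; first by apply/measurable_EFinP; exact: measurable_cst.
    under eq_integral do rewrite /= normr1.
    rewrite integral_cst// mul1e /= lebesgue_measure_itv /= lte_fin.
    by case: ifP => _; rewrite -?EFinB ltry.
  by move=> t _; exact: gauss_weight_le1.
rewrite -[leRHS]mul1r; apply: ler_pM => //.
  by apply: Rintegral_ge0 => t _; exact: gauss_weight_ge0.
rewrite invf_le1 ?sqrt_2pi_gt0// -[leLHS]sqrtr1; apply: ler_wsqrtr.
have := @pi_ge2 R; lra.
Qed.

Lemma ramp_stein z a : 0 < a -> exists f : R -> R, [/\
  forall w : R, is_derive w 1 f (w * f w + (ramp z a w - ramp_mean z a)),
  forall w, `|f w| <= 6 & forall w, `|w * f w| <= 1].
Proof.
move=> a0; apply: stein_equation.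
- move=> x; apply: cvgB; [exact: continuous_ramp|exact: cvg_cst].
- move=> x; rewrite ler_norml.
  have := std_normal_cdf_le_ramp_mean z _ a0.
  have := ramp_mean_le_std_normal_cdf z _ a0.
  have := std_normal_cdf_ge0 z; have := std_normal_cdf_le1 (z + a).
  have := ramp_ge0 z a x; have := ramp_le1 z a x.
  lra.
- have mT : measurable (setT : set R) by [].
  under eq_Rintegral do rewrite mulrBl.
  rewrite RintegralB//; last 2 first.
  + exact: integrable_ramp.
  + by have := integrableZl _ (ramp_mean z a) (integrable_gauss_weight R); apply.
  rewrite RintegralZl//; last exact: integrable_gw.
  rewrite Rintegral_gauss_weight /ramp_mean mulrAC mulVf ?mul1r ?subrr//.
  by rewrite gt_eqF ?sqrt_2pi_gt0.
Qed.

End SmoothedIndicator.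

Arguments ramp {R}.
Arguments ramp_mean {R}.

(** * Normal approximation from a bounded size-biased coupling *)

Section UniformMean.
Variables (R : realType) (T : finType) (A : {set T}).
Implicit Types f g : T -> R.
Local Notation E := (unif_mean A).

Lemma unif_meanD f g : E (fun t => f t + g t) = E f + E g.
Proof. by rewrite /unif_mean big_split /= mulrDl. Qed.

Lemma unif_meanZ (c : R) f : E (fun t => c * f t) = c * E f.
Proof. by rewrite /unif_mean -mulr_sumr mulrA. Qed.

Lemma unif_meanB f g : E (fun t => f t - g t) = E f - E g.
Proof. by rewrite /unif_mean sumrB mulrBl. Qed.

Lemma eq_unif_mean f g : {in A, f =1 g} -> E f = E g.
Proof. by move=> fg; rewrite /unif_mean (eq_bigr g). Qed.

Lemma ler_unif_mean f g : {in A, forall t, f t <= g t} -> E f <= E g.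
Proof. by move=> fg; rewrite ler_wpM2r ?invr_ge0// ler_sum. Qed.

Lemma unif_mean_ge0 f : {in A, forall t, 0 <= f t} -> 0 <= E f.
Proof. by move=> f0; rewrite divr_ge0// sumr_ge0. Qed.

Lemma ler_norm_unif_mean f : `|E f| <= E (fun t => `|f t|).
Proof.
rewrite normrM normfV (ger0_norm (ler0n _ _)) ler_wpM2r ?invr_ge0//.
exact: ler_norm_sum.
Qed.

Lemma unif_prE (P : pred T) : unif_pr R A P = E (fun t => (P t)%:R).
Proof.
rewrite /unif_pr /unif_mean; congr (_ / _).
rewrite -sum1_card natr_sum big_mkcond /= [RHS]big_mkcond /=.
by apply: eq_bigr => t _; rewrite inE; case: (t \in A); case: (P t).
Qed.

Lemma unif_var_ge0 f : 0 <= unif_var A f.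
Proof. by apply: unif_mean_ge0 => t _; exact: sqr_ge0. Qed.

Hypothesis A0 : (0 < #|A|)%N.

Lemma unif_mean_cst (c : R) : E (fun=> c) = c.
Proof.
rewrite /unif_mean sumr_const -[c *+ _]mulr_natr mulfK//.
by rewrite pnatr_eq0 -lt0n.
Qed.

(** Jensen's inequality for the square, from the variance of [`|f - E f|]. *)
Lemma unif_mean_norm_le_sd f :
  E (fun t => `|f t - E f|) <= Num.sqrt (unif_var A f).
Proof.
set g := fun t => `|f t - E f|.
have g0 : 0 <= E g by apply: unif_mean_ge0 => t _; exact: normr_ge0.
rewrite -(ger0_norm g0) -sqrtr_sqr; apply: ler_wsqrtr.
have -> : unif_var A f = E (fun t => g t ^+ 2).
  by apply: eq_unif_mean => t _; rewrite /g real_normK ?num_real.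
have : 0 <= E (fun t => (g t - E g) ^+ 2).
  by apply: unif_mean_ge0 => t _; exact: sqr_ge0.
have -> : E (fun t => (g t - E g) ^+ 2) =
    E (fun t => g t ^+ 2 - ((2 * E g) * g t - E g ^+ 2)).
  by apply: eq_unif_mean => t _; ring.
rewrite unif_meanB unif_meanB unif_meanZ unif_mean_cst.
lra.
Qed.

End UniformMean.

(** The form of the mean value theorem used below: no order between [x] and [y],
    and a point [c] that is only required to be as close to [x] as [y] is. *)
Lemma mean_value (R : realType) (f df : R -> R) (x y : R) :
  (forall u : R, is_derive u 1 f (df u)) ->
  exists2 c, `|c - x| <= `|y - x| & f y - f x = df c * (y - x).
Proof.
move=> fd.
have fc (a b : R) : {within `[a, b], continuous f}%classic.
  apply: continuous_subspaceT => u; apply: differentiable_continuous.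
  by apply/derivable1_diffP; have [] := fd u.
have [xy|/ltW yx] := leP x y.
  have [c] := MVT_segment xy (fun u _ => fd u) (fc _ _).
  rewrite in_itv /= => /andP[xc cy] e; exists c => //.
  by rewrite !ger0_norm ?subr_ge0// lerB.
have [c] := MVT_segment yx (fun u _ => fd u) (fc _ _).
rewrite in_itv /= => /andP[yc cx] e; exists c.
  by rewrite !ler0_norm ?subr_le0// lerN2 lerB.
by rewrite -opprB e; ring.
Qed.

(** Under [coupling], choosing the index [j] with probability [q j / mu] turns
    [W (tau j s)] into a random variable with the size-biased distribution of
    [W], since [coupling] then reads [mu * E f(W^s) = E (W * f W)].  The weights
    are kept unnormalised, which avoids a division by [mu]. *)
Section SteinCoupling.
Variables (R : realType) (T J : finType) (A : {set T}).
Variables (W : T -> R) (q : J -> R) (tau : J -> T -> T) (B V : R).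
Local Notation E := (unif_mean A).
Let mu := E W.
Let sigma := Num.sqrt (unif_var A W).
Let Y s := \sum_j q j * (W (tau j s) - W s).
Hypothesis sigma0 : 0 < sigma.
Hypothesis q_ge0 : forall j, 0 <= q j.
Hypothesis coupling : forall f : R -> R,
  E (fun s => \sum_j q j * f (W (tau j s))) = E (fun s => W s * f (W s)).
Hypothesis B0 : 0 < B.
Hypothesis tau_near : forall j, {in A, forall s, `|W (tau j s) - W s| <= B}.
Hypothesis varY : unif_var A Y <= V.

Let A0 : (0 < #|A|)%N.
Proof.
rewrite lt0n; apply/eqP => A0; move: sigma0.
by rewrite /sigma /unif_var /unif_mean A0 invr0 mulr0 sqrtr0 ltxx.
Qed.

Let w s := (W s - mu) / sigma.
Let b := B / sigma.
Let b0 : 0 < b. Proof. exact: divr_gt0. Qed.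
Let P x := unif_pr R A (fun s => w s <= x).
Local Notation Phi := (@std_normal_cdf R).

Let sum_q : \sum_j q j = mu.
Proof.
have := coupling (fun=> 1).
have -> : E (fun s => W s * 1) = mu.
  by apply: eq_unif_mean => s _; rewrite mulr1.
move=> <-; rewrite -[LHS](unif_mean_cst _ _ _ A0).
by apply: eq_unif_mean => s _; apply: eq_bigr => j _; rewrite mulr1.
Qed.

Let mu0 : 0 <= mu. Proof. by rewrite -sum_q sumr_ge0. Qed.

Let sigma2 : sigma ^+ 2 = unif_var A W.
Proof. by rewrite sqr_sqrtr// unif_var_ge0. Qed.

Let mean_Y : E Y = sigma ^+ 2.
Proof.
rewrite sigma2 /unif_var.
have -> : E Y = E (fun s => \sum_j q j * W (tau j s)) - mu * mu.
  rewrite -{1}sum_q -unif_meanZ -unif_meanB; apply: eq_unif_mean => s _.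
  by rewrite mulr_suml -sumrB; apply: eq_bigr => j _; rewrite mulrBr.
rewrite (coupling id).
have -> : E (fun t => (W t - E W) ^+ 2) =
    E (fun t => W t * W t - ((2 * mu) * W t - mu ^+ 2)).
  by apply: eq_unif_mean => t _; rewrite -/mu; ring.
rewrite unif_meanB unif_meanB unif_meanZ unif_mean_cst// -/mu; ring.
Qed.

Let mean_w2 : E (fun s => w s ^+ 2) = 1.
Proof.
have -> : E (fun s => w s ^+ 2) = (sigma ^+ 2)^-1 * unif_var A W.
  rewrite -unif_meanZ; apply: eq_unif_mean => s _.
  by rewrite /w -/mu exprMn exprVn mulrC.
by rewrite -sigma2 mulVf// expf_eq0 gt_eqF.
Qed.

Let mean_norm_w : E (fun s => `|w s|) <= 1.
Proof.
apply: (@le_trans _ _ (E (fun s => 2^-1 * (1 + w s ^+ 2)))).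
  apply: ler_unif_mean => s _; rewrite -(real_normK (num_real (w s))).
  have := sqr_ge0 (`|w s| - 1); rewrite sqrrB1; lra.
rewrite unif_meanZ unif_meanD mean_w2 unif_mean_cst//; lra.
Qed.

Section Step.
Variables (d z a : R).
Hypothesis a0 : 0 < a.
Hypothesis a_big : mu / sigma * b ^+ 2 <= a / 8.
Hypothesis P_near : forall x, `|P x - Phi x| <= d.
Let I := fun s : T => ((z - b <= w s <= z + a + b)%R%:R : R).

Let mean_I : E I <= 2 * d + (a + 3 * b).
Proof.
have bpos := b0; have apos := a0.
have h : E I <= P (z + a + b) - P (z - 2 * b).
  rewrite /P !unif_prE -unif_meanB; apply: ler_unif_mean => s _; rewrite /I.
  case: (lerP (w s) (z + a + b)) => h1; rewrite ?andbT ?andbF.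
    case: (lerP (w s) (z - 2 * b)) => h2; last by rewrite subr0 lern1 leq_b1.
    have -> : (z - b <= w s) = false by apply/negbTE; rewrite -ltNge; lra.
    by rewrite subrr.
  case: (lerP (w s) (z - 2 * b)) => h2; last by rewrite subr0.
  by exfalso; lra.
have h3 := P_near (z + a + b); have h4 := P_near (z - 2 * b).
have h5 : Phi (z + a + b) <= Phi (z - 2 * b) + (z + a + b - (z - 2 * b)).
  by apply: std_normal_cdf_lip; lra.
move: h3 h4; rewrite !ler_norml; lra.
Qed.

(** Let [f] solve Stein's equation for the ramp and [df] be its derivative.  The
    quantity to bound is [E (df w - w * f w)].  By [coupling], [E (w * f w)] is
    the expectation of [sigma^-1 * \sum_j q j * (f (w_j) - f w)], where [w_j]
    is the standardised value of [W (tau j s)].  Replacing [f (w_j) - f w] by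
    [df w * (w_j - w)] leaves [df w * (1 - Y / sigma ^+ 2)], which the variance
    of [Y] controls because [E Y = sigma ^+ 2]; the error of the replacement is
    controlled by the oscillation of [df] at distance [b].  The ramp
    contributes to that oscillation only when [w] is within [b] of the interval
    from [z] to [z + a], and the probability of this event is again compared
    with the normal one: this is where [d] comes back, with a factor that
    [a_big] makes as small as [1 / 4]. *)
Lemma stein_step :
  `|E (fun s => ramp z a (w s)) - ramp_mean z a| <=
  2 * (Num.sqrt V / sigma ^+ 2) + 9 * (mu / sigma * b ^+ 2) + 3 / 8 * b + d / 4.
Proof.
have [f [fD f6 fw1]] := ramp_stein _ z a a0.
set df := fun x => x * f x + (ramp z a x - ramp_mean z a).
have df2 x : `|df x| <= 2.
  rewrite /df (le_trans (ler_normD _ _))//.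
  suff : `|ramp z a x - ramp_mean z a| <= 1 by have := fw1 x; lra.
  have := std_normal_cdf_le_ramp_mean _ z _ a0.
  have := ramp_mean_le_std_normal_cdf _ z _ a0.
  have := std_normal_cdf_ge0 _ z; have := std_normal_cdf_le1 _ (z + a).
  have := ramp_ge0 _ z a x; have := ramp_le1 _ z a x.
  rewrite ler_norml; lra.
(* [D s] bounds the oscillation of [df] within distance [b] of [w s]. *)
pose D s := b * (6 + 2 * `|w s|) + b / a * I s.
have osc s c : `|c - w s| <= b -> `|df c - df (w s)| <= D s.
  move=> cb.
  have -> : df c - df (w s) = (c - w s) * f c + w s * (f c - f (w s)) +
     (ramp z a c - ramp z a (w s)) by rewrite /df; ring.
  rewrite (le_trans (ler_normD _ _))// lerD//.
    rewrite [leRHS]mulrDr (le_trans (ler_normD _ _))// lerD// normrM.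
      by apply: ler_pM.
    have [e _ ->] := mean_value _ f df (w s) c fD.
    rewrite [leRHS](_ : _ = `|w s| * (2 * b)); last by ring.
    by rewrite ler_wpM2l// normrM ler_pM.
  rewrite /I; case: (boolP (z - b <= w s <= z + a + b)) => [_|].
    rewrite mulr1 (le_trans (ramp_lip _ _ _ _ _ a0))//.
    by rewrite ler_pM2r ?invr_gt0.
  (* Far from the slope of the ramp, both ramp values are 1 or both are 0. *)
  rewrite mulr0 negb_and -!ltNge; have apos := a0; have bpos := b0.
  move: cb; rewrite ler_norml => /andP[c1 c2] /orP[h|h].
    by rewrite !ramp_left ?subrr ?normr0//; lra.
  by rewrite !ramp_right ?subrr ?normr0//; lra.
have D0 s : 0 <= D s.
  by rewrite addr_ge0// mulr_ge0 ?divr_ge0 ?ler0n ?ltW// addr_gt0// ?mulr_ge0.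
have meanD : E D <= 8 * b + b / a * (2 * d + (a + 3 * b)).
  rewrite unif_meanD !unif_meanZ unif_meanD unif_meanZ unif_mean_cst//.
  apply: lerD; last by rewrite ler_wpM2l// ltW// divr_gt0.
  rewrite mulrC ler_wpM2r ?(ltW b0)//; have := mean_norm_w; lra.
pose K s := sigma^-1 * \sum_j q j * (f ((W (tau j s) - mu) / sigma) - f (w s)).
have meanK : E (fun s => w s * f (w s)) = E K.
  pose F v := f ((v - mu) / sigma).
  have -> : E (fun s => w s * f (w s)) =
      sigma^-1 * (E (fun s => W s * F (W s)) - mu * E (fun s => F (W s))).
    rewrite -unif_meanZ -unif_meanB -unif_meanZ; apply: eq_unif_mean => s _.
    by rewrite /F -/(w s) {1}/w; ring.
  rewrite -(coupling F) -{1}sum_q -unif_meanZ -unif_meanB -unif_meanZ.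
  apply: eq_unif_mean => s _; rewrite /K; congr (_ * _).
  by rewrite mulr_suml -sumrB; apply: eq_bigr => j _; rewrite mulrBr.
have ptw s : s \in A -> `|df (w s) - K s| <=
    2 / sigma ^+ 2 * `|Y s - sigma ^+ 2| + (mu / sigma) * b * D s.
  move=> sA; pose v j := (W (tau j s) - mu) / sigma.
  have vw j : `|v j - w s| <= b.
    rewrite /v /w -mulrBl normrM normfV (gtr0_norm sigma0) ler_pM2r ?invr_gt0//.
    by rewrite opprB addrA subrK tau_near.
  have -> : df (w s) - K s = df (w s) * ((sigma ^+ 2 - Y s) / sigma ^+ 2) -
      sigma^-1 * \sum_j q j * (f (v j) - f (w s) - df (w s) * (v j - w s)).
    have -> : \sum_j q j * (f (v j) - f (w s) - df (w s) * (v j - w s)) =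
        \sum_j q j * (f (v j) - f (w s)) - df (w s) * (Y s / sigma).
      rewrite /Y mulr_suml mulr_sumr -sumrB; apply: eq_bigr => j _.
      by rewrite /v /w; field; rewrite gt_eqF.
    by rewrite /K /v; field; rewrite gt_eqF.
  rewrite (le_trans (ler_normB _ _))// lerD//.
    rewrite !normrM normfV (ger0_norm (ltW (exprn_gt0 2 sigma0))) distrC.
    rewrite [leRHS]mulrAC -mulrA ler_pM// ?mulr_ge0// ?invr_ge0 ?exprn_ge0 ?ltW//.
  rewrite normrM normfV (gtr0_norm sigma0).
  rewrite [leRHS](_ : _ = sigma^-1 * (mu * (b * D s))); last by ring.
  rewrite ler_wpM2l ?invr_ge0 ?(ltW sigma0)// -sum_q mulr_suml.
  rewrite (le_trans (ler_norm_sum _ _ _))// ler_sum// => j _.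
  rewrite normrM (ger0_norm (q_ge0 j)) ler_wpM2l//.
  have [c cv ->] := mean_value _ f df (w s) (v j) fD.
  rewrite -mulrBl normrM mulrC ler_pM// osc//.
  exact: le_trans cv (vw j).
have -> : E (fun s => ramp z a (w s)) - ramp_mean z a = E (fun s => df (w s) - K s).
  rewrite unif_meanB -meanK -unif_meanB.
  transitivity (E (fun s => ramp z a (w s) - ramp_mean z a)).
    by rewrite unif_meanB unif_mean_cst.
  by apply: eq_unif_mean => s _; rewrite /df; ring.
rewrite (le_trans (ler_norm_unif_mean _ _ _ _))//.
rewrite (le_trans (ler_unif_mean _ _ _ _ _ ptw))//.
rewrite unif_meanD !unif_meanZ.
have h1 : E (fun t => `|Y t - sigma ^+ 2|) <= Num.sqrt V.
  rewrite -mean_Y; apply: (le_trans (unif_mean_norm_le_sd _ _ _ A0 _)).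
  exact: ler_wsqrtr.
have h2 : 2 / sigma ^+ 2 * E (fun t => `|Y t - sigma ^+ 2|) <=
    2 * (Num.sqrt V / sigma ^+ 2).
  rewrite [leRHS](_ : _ = 2 / sigma ^+ 2 * Num.sqrt V); last by ring.
  by rewrite ler_wpM2l// divr_ge0// exprn_ge0// ltW.
have h3 : mu / sigma * b * E D <= 9 * (mu / sigma * b ^+ 2) + 3 / 8 * b + d / 4.
  have m0 : 0 <= mu / sigma * b.
    exact: mulr_ge0 (divr_ge0 mu0 (ltW sigma0)) (ltW b0).
  apply: (le_trans (ler_wpM2l m0 meanD)).
  have d0 : 0 <= d by apply: le_trans (P_near 0); exact: normr_ge0.
  set x := mu / sigma * b ^+ 2.
  have xa : x / a <= 1 / 8 by rewrite ler_pdivrMr//; have := a_big; rewrite -/x; lra.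
  have -> : mu / sigma * b * (8 * b + b / a * (2 * d + (a + 3 * b))) =
      9 * x + x / a * (2 * d + 3 * b).
    by rewrite /x; field; rewrite !gt_eqF.
  have : x / a * (2 * d + 3 * b) <= 1 / 8 * (2 * d + 3 * b).
    by rewrite ler_wpM2r// addr_ge0// mulr_ge0// ltW.
  lra.
lra.
Qed.
End Step.

Let x0 := mu / sigma * b ^+ 2.
Let eps := 2 * (Num.sqrt V / sigma ^+ 2) + 17 * x0 + 2 * b.

(** Sandwiching the indicator of [w <= z] between two ramps of slope width [a]
    costs [a] more.  The width is taken as [8 * x0 + b]: the first summand makes
    the coefficient of [d] equal to [1 / 4], and the second one, which is of the
    order of [sigma^-1], keeps the width positive. *)
Let self_improvement d : (forall x, `|P x - Phi x| <= d) ->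
  forall x, `|P x - Phi x| <= eps + d / 4.
Proof.
move=> dP z.
have x00 : 0 <= x0.
  exact: mulr_ge0 (divr_ge0 mu0 (ltW sigma0)) (exprn_ge0 _ (ltW b0)).
have bpos := b0.
pose a := 8 * x0 + b.
have a0 : 0 < a by rewrite /a; lra.
have a8 : mu / sigma * b ^+ 2 <= a / 8 by rewrite -/x0 /a; lra.
have up := stein_step d z a a0 a8 dP.
have lo := stein_step d (z - a) a a0 a8 dP.
have Pup : P z <= E (fun s => ramp z a (w s)).
  rewrite /P unif_prE; apply: ler_unif_mean => s _.
  by case: (lerP (w s) z) => h; rewrite ?ramp_ge0// ramp_left.
have Plo : E (fun s => ramp (z - a) a (w s)) <= P z.
  rewrite /P unif_prE; apply: ler_unif_mean => s _.
  case: (lerP (w s) z) => h; rewrite ?ramp_le1// ramp_right//.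
  by rewrite subrK ltW.
have N1 := ramp_mean_le_std_normal_cdf _ z _ a0.
have N2 := std_normal_cdf_le_ramp_mean _ (z - a) _ a0.
have L1 : Phi (z + a) <= Phi z + (z + a - z).
  by apply: std_normal_cdf_lip; lra.
have L2 : Phi z <= Phi (z - a) + (z - (z - a)).
  by apply: std_normal_cdf_lip; lra.
move: up lo; rewrite !ler_norml -/x0 /eps => /andP[u1 u2] /andP[l1 l2].
by apply/andP; split; rewrite /a in Pup Plo N1 N2 L1 L2 u1 u2 l1 l2; lra.
Qed.

(** The Kolmogorov distance is the least admissible [d] in [self_improvement],
    so it is at most [eps] plus a quarter of itself. *)
Theorem size_bias_kolmogorov_bound x :
  `|unif_pr R A (fun s => (W s - mu) / sigma <= x) - Phi x| <=
  4 * (Num.sqrt V / sigma ^+ 2) + 24 * (mu / sigma * (B / sigma) ^+ 2)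
  + 4 * (B / sigma).
Proof.
pose S : set R := [set u | exists y, u = `|P y - Phi y|]%classic.
have S0 : (S !=set0)%classic by exists `|P 0 - Phi 0|, 0.
have Sub : has_ubound S.
  exists 1 => _ [y ->].
  have := std_normal_cdf_ge0 R y; have := std_normal_cdf_le1 R y.
  have : 0 <= P y by rewrite /P unif_prE; apply: unif_mean_ge0.
  have : P y <= 1.
    rewrite /P unif_prE -[leRHS](unif_mean_cst _ _ _ A0).
    by apply: ler_unif_mean => s _; rewrite lern1 leq_b1.
  rewrite ler_norml; lra.
have le_sup y : `|P y - Phi y| <= sup S by apply: ub_le_sup => //; exists y.
have sup_le : sup S <= eps + sup S / 4.
  by apply: ge_sup => // _ [y ->]; exact: self_improvement.
apply: (le_trans (le_sup x)).
have bpos := b0.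
have x00 : 0 <= x0.
  exact: mulr_ge0 (divr_ge0 mu0 (ltW sigma0)) (exprn_ge0 _ (ltW b0)).
have v0 : 0 <= Num.sqrt V / sigma ^+ 2.
  by rewrite divr_ge0 ?sqrtr_ge0 ?sqr_ge0.
rewrite -/b -/x0; move: sup_le; rewrite /eps; lra.
Qed.

End SteinCoupling.

(** * Variance of a function of a random matching of two decks *)

Section TotalVariance.
Variables (R : realType) (T I : finType) (S : {set T}) (k : T -> I).
Variables (Y : T -> R) (v K : R).
Let fib c := [set t in S | k t == c].

Lemma sum_fibres (F : T -> R) :
  \sum_(t in S) F t = \sum_c \sum_(t in fib c) F t.
Proof.
rewrite (partition_big k xpredT)//=; apply: eq_bigr => c _.
by apply: eq_bigl => t; rewrite inE.
Qed.

(** Law of total variance: the variance is the mean of the variances within the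
    fibres of [k] plus the variance of the fibre means, and the mean of the
    fibre means is within [K] of each of them. *)
Lemma unif_var_fibres : 0 <= v ->
  (forall c, unif_var (fib c) Y <= v) ->
  (forall c c', fib c != finset.set0 -> fib c' != finset.set0 ->
    `|unif_mean (fib c) Y - unif_mean (fib c') Y| <= K) ->
  unif_var S Y <= v + K ^+ 2.
Proof.
move=> v0 hv hK.
have [->|[t0 t0S]] := set_0Vmem S.
  by rewrite /unif_var /unif_mean big_set0 mul0r addr_ge0// sqr_ge0.
have S0 : (0 < #|S|)%N by apply/card_gt0P; exists t0.
have fib0 t : t \in S -> fib (k t) != finset.set0.
  by move=> tS; apply/set0Pn; exists t; rewrite inE tS /=.
set M := unif_mean S Y.
have mM : unif_mean S (fun t => unif_mean (fib (k t)) Y) = M.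
  rewrite /M /unif_mean; congr (_ / _); rewrite !sum_fibres.
  apply: eq_bigr => c _.
  rewrite (eq_bigr (fun=> unif_mean (fib c) Y)); last first.
    by move=> t; rewrite inE => /andP[_ /eqP ->].
  have [->|[t tc]] := set_0Vmem (fib c); first by rewrite !big_set0.
  rewrite sumr_const -[_ *+ _]mulr_natr /unif_mean mulfVK//.
  by rewrite pnatr_eq0 -lt0n; apply/card_gt0P; exists t.
have mcM c : fib c != finset.set0 -> `|unif_mean (fib c) Y - M| <= K.
  move=> c0; rewrite -(unif_mean_cst R _ S S0 (unif_mean (fib c) Y)) -mM -unif_meanB.
  apply: (le_trans (ler_norm_unif_mean _ _ _ _)).
  rewrite -[leRHS](unif_mean_cst R _ S S0); apply: ler_unif_mean => t tS.
  by apply: hK => //; exact: fib0.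
rewrite /unif_var -/M ler_pdivrMr ?ltr0n// sum_fibres.
rewrite -sum1_card natr_sum mulr_sumr sum_fibres; apply: ler_sum => c _.
have [->|[t tc]] := set_0Vmem (fib c); first by rewrite !big_set0.
have c0 : (0 < #|fib c|)%N by apply/card_gt0P; exists t.
rewrite -mulr_sumr -natr_sum sum1_card -ler_pdivrMr ?ltr0n//.
rewrite -[leLHS]/(unif_mean (fib c) (fun t => (Y t - M) ^+ 2)).
set m := unif_mean (fib c) Y.
have -> : unif_mean (fib c) (fun t => (Y t - M) ^+ 2) =
  unif_var (fib c) Y + (m - M) ^+ 2.
  transitivity (unif_mean (fib c) (fun t =>
     (Y t - m) ^+ 2 + ((2 * (m - M)) * (Y t - m) + (m - M) ^+ 2))).
    by apply: eq_unif_mean => u _; ring.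
  rewrite unif_meanD unif_meanD unif_meanZ unif_meanB !unif_mean_cst//.
  by rewrite -/m subrr mulr0 add0r.
apply: lerD; first exact: hv.
rewrite -(real_normK (num_real (m - M))) lerXn2r ?nnegrE//.
  apply: le_trans (mcM c _) => //; by apply/set0Pn; exists t.
by apply: mcM; apply/set0Pn; exists t.
Qed.

End TotalVariance.

Section DeckVariance.
Variables (R : realType) (L : eqType) (n : nat) (D1 D2 : n.-tuple L).
Local Notation Pi := (deck_perms D1 D2).
Variables (Y : 'S_n -> R) (K : R).
Hypothesis Y_lip : forall s c c', s \in Pi -> tnth D2 c = tnth D2 c' ->
  `|Y (s * tperm c c')%g - Y s| <= K.

Lemma deck_permsP (s : 'S_n) :
  reflect (forall i, tnth D1 i = tnth D2 (s i)) (s \in Pi).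
Proof. by rewrite inE; apply: (iffP forallP) => h i; apply/eqP. Qed.

Lemma deck_perms_swap (s : 'S_n) c c' :
  s \in Pi -> tnth D2 c = tnth D2 c' -> (s * tperm c c')%g \in Pi.
Proof.
move=> /deck_permsP sP cc'; apply/deck_permsP => i; rewrite permM sP.
by case: tpermP => [->|->|].
Qed.

(** The permutations still possible once the values at the positions below [k]
    have been revealed to be those of [rho]. *)
Let pref (rho : 'S_n) k :=
  [set s in Pi | [forall i : 'I_n, (i < k)%N ==> (s i == rho i)]].

Let prefP (rho s : 'S_n) k :
  reflect (s \in Pi /\ forall i : 'I_n, (i < k)%N -> s i = rho i) (s \in pref rho k).
Proof.
rewrite [X in reflect _ X]finset.in_set.
apply: (iffP andP) => [[sP /forallP h]|[sP h]]; split => //.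
  by move=> i ik; apply/eqP; exact: (implyP (h i)).
by apply/forallP => i; apply/implyP => /h ->.
Qed.

(** Revealing one more value splits the set into fibres; the swap of the values
    [c] and [c'] maps the fibre of [c] onto that of [c'], so that the means of
    [Y] on the two fibres differ by at most [K]. *)
Let pref_var m k rho : (k + m)%N = n -> unif_var (pref rho k) Y <= m%:R * K ^+ 2.
Proof.
elim: m k rho => [|m IH] k rho km.
  rewrite mul0r.
  have sub s : s \in pref rho k -> s = rho.
    by case/prefP => _ h; apply/permP => i; apply: h; rewrite -[k]addn0 km.
  rewrite /unif_var /unif_mean.
  have [->|[s /[dup] /sub -> rin]] := set_0Vmem (pref rho k).
    by rewrite big_set0 mul0r.
  have -> : pref rho k = [set rho]%SET.
    by apply/setP => t; rewrite finset.in_set1; apply/idP/eqP => [/sub//|->].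
  by rewrite !big_set1 cards1 !divr1 subrr expr0n.
have kn : (k < n)%N by rewrite -km addnS ltnS leq_addr.
pose i0 := Ordinal kn.
rewrite -natr1 mulrDl mul1r.
apply: (unif_var_fibres _ _ _ _ (fun s : 'S_n => s i0)).
- by rewrite mulr_ge0 ?sqr_ge0.
- move=> c.
  have [->|[s]] := set_0Vmem [set t in pref rho k | t i0 == c].
    by rewrite /unif_var /unif_mean big_set0 mul0r mulr_ge0 ?sqr_ge0.
  rewrite finset.in_set => /andP[/prefP[sP sh] /eqP sc].
  have -> : [set t in pref rho k | t i0 == c] = pref s k.+1.
    apply/setP => t; rewrite finset.in_set; apply/andP/prefP.
      move=> [/prefP[tP th] /eqP tc]; split=> // i.
      rewrite ltnS leq_eqVlt => /predU1P[ik|ik]; last by rewrite th// sh.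
      by have -> : i = i0 by [apply: val_inj]; rewrite tc.
    move=> [tP th]; split; last by rewrite th /= ?sc.
    by apply/prefP; split=> // i ik; rewrite th ?sh// ltnW.
  by apply: IH; rewrite addSnnS.
- move=> c c' /set0Pn[s] /[1!finset.in_set] /andP[/prefP[sP sh] /eqP sc].
  move=> /set0Pn[s'] /[1!finset.in_set] /andP[/prefP[s'P s'h] /eqP s'c'].
  set F := fun c => [set t in pref rho k | t i0 == c].
  have cc' : tnth D2 c = tnth D2 c'.
    move/deck_permsP: sP => /(_ i0).
    by move/deck_permsP: s'P => /(_ i0); rewrite sc s'c' => -> ->.
  have avoid (i : 'I_n) : (i < k)%N -> (rho i != c) && (rho i != c').
    move=> ik; rewrite -{1}(sh i ik) -{1}(s'h i ik) -sc -s'c' !(inj_eq perm_inj).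
    have -> : i == i0 = false by apply/eqP => e; rewrite e ltnn in ik.
    by [].
  have swapF x y t : tnth D2 x = tnth D2 y -> 
     (forall i : 'I_n, (i < k)%N -> (rho i != x) && (rho i != y)) ->
     t \in F x -> (t * tperm x y)%g \in F y.
    move=> xy av; rewrite ![_ \in F _]finset.in_set => /andP[/prefP[tP th] /eqP tx].
    rewrite permM tx tpermL eqxx andbT; apply/prefP; split.
      exact: deck_perms_swap.
    move=> i ik; rewrite permM th//; have /andP[h1 h2] := av i ik.
    by rewrite tpermD// eq_sym.
  have e : F c' = [set (t * tperm c c')%g | t in F c].
    apply/setP => t; apply/idP/imsetP.
      move=> tc'; exists (t * tperm c c')%g; last by rewrite -mulgA tperm2 mulg1.
      rewrite tpermC; apply: swapF => // i ik.
      by rewrite andbC; exact: avoid.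
    by move=> [u uc ->]; exact: swapF.
  have tinj : injective (fun t : 'S_n => (t * tperm c c')%g) by exact: mulIg.
  have -> : unif_mean (F c') Y = unif_mean (F c) (fun t => Y (t * tperm c c')%g).
    rewrite /unif_mean e card_imset// big_imset//=.
    by move=> x y _ _; exact: tinj.
  rewrite distrC -unif_meanB (le_trans (ler_norm_unif_mean _ _ _ _))//.
  have F0 : (0 < #|F c|)%N.
    apply/card_gt0P; exists s; rewrite finset.in_set sc eqxx andbT; exact/prefP.
  rewrite -[leRHS](unif_mean_cst R _ (F c) F0); apply: ler_unif_mean => t.
  by rewrite finset.in_set => /andP[/prefP[tP _] _]; exact: Y_lip.
Qed.

Lemma deck_unif_var_le : unif_var Pi Y <= n%:R * K ^+ 2.
Proof.
have -> : Pi = pref 1%g 0 by apply/setP => s; apply/idP/prefP => [//|[]].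
exact: pref_var.
Qed.

End DeckVariance.

(** * The size-biased coupling for descents *)

Definition force n (i a : 'I_n) (s : 'S_n) : 'S_n := (s * tperm (s i) a)%g.
Arguments force {n}.

(** Forcing the value at [i] maps the uniform distribution on [S] to the uniform
    distribution on the permutations of [S] with value [a] at [i]: each of them
    has one preimage for each possible old value [c] at [i]. *)
Lemma sum_force (R : realType) n (S : {set 'S_n}) (V : {set 'I_n}) (i a : 'I_n)
    (F : 'S_n -> R) :
  (forall s c, s \in S -> c \in V -> (s * tperm c a)%g \in S) ->
  (forall s, s \in S -> s i \in V) ->
  \sum_(s in S) F (force i a s) = #|V|%:R * \sum_(s in S | s i == a) F s.
Proof.
move=> SV Vi.
rewrite (partition_big (fun s : 'S_n => s i) (mem V))//=.
rewrite mulr_natl -sumr_const; apply: eq_bigr => c cV.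
have inv : involutive (fun s : 'S_n => (s * tperm c a)%g).
  by move=> s; rewrite -mulgA tperm2 mulg1.
rewrite (reindex_inj (inv_inj inv)) /=.
have SE s : ((s * tperm c a)%g \in S) = (s \in S).
  apply/idP/idP => h; last exact: SV.
  by rewrite -(inv s); exact: SV.
apply: eq_big => s.
  rewrite SE permM; congr (_ && _).
  apply/eqP/eqP => [h|->]; last exact: tpermR.
  by rewrite -(tpermK c a (s i)) h tpermL.
by move=> /andP[_ /eqP sc]; rewrite /force sc -mulgA tperm2 mulg1.
Qed.

(** Descents are counted along abstract edges from the position [l e] to the
    position [r e]: all that matters about consecutive positions is that a
    position starts at most one edge and ends at most one other edge. *)
Section Descents.
Variables (R : realType) (n : nat) (E : finType) (l r : E -> 'I_n).
Hypothesis l_inj : injective l.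
Hypothesis r_inj : injective r.
Hypothesis lr : forall e, l e != r e.
Implicit Types (s t u : 'S_n) (e : E) (Z : {set 'I_n}).

Definition descent_at e s : bool := (s (r e) < s (l e))%N.
Definition descents s : R := \sum_e (descent_at e s)%:R.
Definition impose e t s := force (r e) (t (r e)) (force (l e) (t (l e)) s).

Definition incident s Z : R :=
  \sum_e ((s (l e) \in Z)%:R + (s (r e) \in Z)%:R).

(** Each value occurs once in [s], and each position is at most once an [l e] and
    at most once an [r e]. *)
Lemma incident_le s Z : incident s Z <= 2 * #|Z|%:R.
Proof.
have h (k : E -> 'I_n) : injective k -> \sum_e (s (k e) \in Z)%:R <= #|Z|%:R :> R.
  move=> kinj; rewrite -natr_sum ler_nat.
  rewrite (_ : (\sum_e _)%N = #|[set e | s (k e) \in Z]%SET|); last first.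
    rewrite -sum1_card [RHS]big_mkcond /=; apply: eq_bigr => e _.
    by rewrite finset.in_set; case: (_ \in _).
  rewrite -(card_imset _ (inj_comp (@perm_inj _ s) kinj)).
  by apply/subset_leq_card/fintype.subsetP => v /imsetP[e /[!inE] h ->].
rewrite /incident big_split /= mulrDl !mul1r lerD ?h//.
Qed.

Lemma descents_move s u Z : (forall v, v \notin Z -> u v = v) ->
  `|descents (s * u)%g - descents s| <= 2 * #|Z|%:R.
Proof.
move=> uZ; apply: le_trans (incident_le s Z).
rewrite /descents /incident -sumrB (le_trans (ler_norm_sum _ _ _))//.
apply: ler_sum => e _.
have b01 (b : bool) : 0 <= (b%:R : R) <= 1 by case: b; rewrite ?lexx ?ler01.
have [xZ|xZ] := boolP (s (l e) \in Z).
  have := b01 (descent_at e (s * u)%g); have := b01 (descent_at e s).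
  have := b01 (s (r e) \in Z).
  rewrite ler_norml /=; lra.
have [yZ|yZ] := boolP (s (r e) \in Z).
  have := b01 (descent_at e (s * u)%g); have := b01 (descent_at e s).
  rewrite ler_norml /=; lra.
by rewrite /descent_at !permM !uZ// subrr normr0 addr0.
Qed.

Lemma tperm_out (c c' v : 'I_n) : v \notin [set c; c']%SET -> tperm c c' v = v.
Proof.
by rewrite finset.in_set2 negb_or => /andP[h1 h2]; rewrite tpermD// eq_sym.
Qed.

Lemma descents_tperm s c c' : `|descents (s * tperm c c')%g - descents s| <= 4.
Proof.
apply: (le_trans (descents_move s _ _ (@tperm_out c c'))).
have : (#|[set c; c']%SET| <= 2)%N by rewrite cards2 ltnS leq_b1.
rewrite -(ler_nat R); lra.
Qed.

Lemma descents_impose e t s : `|descents (impose e t s) - descents s| <= 8.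
Proof.
rewrite /impose; set s1 := force (l e) (t (l e)) s.
have h1 := descents_tperm s (s (l e)) (t (l e)).
have h2 := descents_tperm s1 (s1 (r e)) (t (r e)).
move: h1 h2; rewrite -/(force (l e) (t (l e)) s) -/(force (r e) (t (r e)) s1) -/s1.
rewrite !ler_norml; lra.
Qed.

(** The values that [s] takes on [Z]-valued positions and on their neighbours
    along an edge. *)
Definition adjacent_values s Z : {set 'I_n} :=
  (Z :|: [set s (r e) | e in [set e | s (l e) \in Z]]
     :|: [set s (l e) | e in [set e | s (r e) \in Z]])%SET.

Lemma card_adjacent_values s Z : (#|adjacent_values s Z| <= 3 * #|Z|)%N.
Proof.
have h (k k' : E -> 'I_n) : injective k ->
   (#|[set s (k' e) | e in [set e | s (k e) \in Z]%SET]%SET| <= #|Z|)%N.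
  move=> kinj; apply: (leq_trans (leq_imset_card _ _)).
  rewrite -(card_imset _ (inj_comp (@perm_inj _ s) kinj)).
  by apply/subset_leq_card/fintype.subsetP => v /imsetP[e /[!inE] ? ->].
rewrite /adjacent_values (leq_trans (leq_card_setU _ _))//.
rewrite [X in (_ <= X)%N](_ : _ = #|Z| + #|Z| + #|Z|)%N; last by ring.
by rewrite leq_add ?h// (leq_trans (leq_card_setU _ _))// leq_add ?h.
Qed.

(** Imposing [t] on [e] and moving the values in [Z] do not interact unless a
    value displaced by the former is adjacent to [Z]: the two permutations
    commute, and no edge carries both a value displaced by the one and a value
    displaced by the other.  So the effects on the number of descents add up. *)
Lemma impose_local e t s u Z :
  let B := adjacent_values s Z in
  (forall v, v \notin Z -> u v = v) ->
  s (l e) \notin B -> s (r e) \notin B -> t (l e) \notin B -> t (r e) \notin B ->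
  descents (impose e t (s * u)%g) - descents (s * u)%g =
  descents (impose e t s) - descents s.
Proof.
move=> B uZ sl sr tl tr.
have ZB v : v \notin B -> v \notin Z.
  by apply: contra => vZ; rewrite !inE vZ.
set M := [:: s (l e); s (r e); t (l e); t (r e)].
have MB v : v \in M -> v \notin B.
  by rewrite !(in_cons, in_nil) orbF => /or4P[] /eqP ->.
(* [x] is the value at [r e] after the first of the two swaps. *)
pose x := tperm (s (l e)) (t (l e)) (s (r e)).
pose g := (tperm (s (l e)) (t (l e)) * tperm x (t (r e)))%g.
have xM : x \in M.
  by rewrite /x; case: tpermP => _; rewrite !inE eqxx ?orbT.
have gs : impose e t s = (s * g)%g by rewrite /impose /force /g /x permM mulgA.
have gus : impose e t (s * u)%g = (s * u * g)%g.
  rewrite /impose /force /g /x !permM (uZ (s (l e))) ?ZB//.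
  by rewrite (uZ (s (r e))) ?ZB// mulgA.
have gM v : v \notin M -> g v = v.
  move=> vM; have ne m : m \in M -> m != v by apply: contraTneq => ->.
  rewrite /g permM !tpermD// ?ne// !inE ?eqxx ?orbT//.
clearbody g.
rewrite gs gus /descents -!sumrB; apply: eq_bigr => e' _.
have BZ1 : s (l e') \in Z -> s (r e') \in B.
  move=> h; rewrite !inE; apply/orP; left; apply/orP; right.
  by apply/imsetP; exists e'; rewrite ?inE.
have BZ2 : s (r e') \in Z -> s (l e') \in B.
  by move=> h; rewrite !inE; apply/orP; right; apply/imsetP; exists e'; rewrite ?inE.
have [/orP h|] := boolP ((s (l e') \in M) || (s (r e') \in M)).
  have [lZ rZ] : s (l e') \notin Z /\ s (r e') \notin Z.
    case: h => /MB h; split; try exact: ZB.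
      by apply: contra h.
    by apply: contra h.
  by rewrite /descent_at !permM !(uZ (s _)).
rewrite negb_or => /andP[lM rM].
have uM v : v \notin M -> u v \notin M.
  move=> vM; have [vZ|/uZ -> //] := boolP (v \in Z).
  have : u v \in Z.
    apply: contraLR vZ => uvZ; have /perm_inj uv := uZ _ uvZ.
    by move: uvZ; rewrite uv.
  apply: contraL => /MB; exact: ZB.
by rewrite /descent_at !permM !gM ?uM// !subrr.
Qed.

Section Deck.
Variables (L : eqType) (D1 D2 : n.-tuple L).
Local Notation Pi := (deck_perms D1 D2).

(** Drawing [t] uniformly and keeping it only if it has a descent at [e] makes
    [(t (l e), t (r e))] follow the law of the two values given a descent at [e],
    times the probability of that descent. *)
Definition impose_weight (j : E * 'S_n) : R :=
  ((j.2 \in Pi) && descent_at j.1 j.2)%:R / #|Pi|%:R.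

Lemma impose_weight_ge0 j : 0 <= impose_weight j.
Proof. by rewrite divr_ge0. Qed.

Let agree e t := [set s in Pi | (s (l e) == t (l e)) && (s (r e) == t (r e))]%SET.

Let agreeP e t s :
  reflect [/\ s \in Pi, s (l e) = t (l e) & s (r e) = t (r e)] (s \in agree e t).
Proof.
rewrite [X in reflect _ X]finset.in_set; apply: (iffP and3P).
  by move=> [? /eqP ? /eqP ?].
by move=> [? -> ->].
Qed.

(** If [s] is uniform, then [impose e t s] is uniform on the permutations that
    agree with [t] at both ends of [e].  Both swaps preserve uniformity by
    [sum_force]; the second one cannot destroy the value set by the first
    because [t] takes different values at [l e] and [r e].  The number of
    preimages is the same for every [F], and is found by taking [F] constant. *)
Lemma sum_impose (F : 'S_n -> R) e t : t \in Pi ->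
  (\sum_(s in Pi) F (impose e t s)) * #|agree e t|%:R =
  #|Pi|%:R * \sum_(s in agree e t) F s.
Proof.
move=> tP.
suff [N HN] : exists N : R, forall F : 'S_n -> R,
    \sum_(s in Pi) F (impose e t s) = N * \sum_(s in agree e t) F s.
  have := HN (fun=> 1); rewrite !sumr_const => ->; rewrite HN.
  by rewrite mulrAC.
pose V1 := [set c | tnth D2 c == tnth D2 (t (l e))]%SET.
pose V2 := [set c | (tnth D2 c == tnth D2 (t (r e))) && (c != t (l e))]%SET.
pose S := [set s in Pi | s (l e) == t (l e)]%SET.
have ba : t (r e) != t (l e) by rewrite (inj_eq perm_inj) eq_sym lr.
exists (#|V1|%:R * #|V2|%:R) => F'.
rewrite /impose.
rewrite (sum_force _ _ Pi V1 _ _ (fun s => F' (force (r e) (t (r e)) s))).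
- rewrite -mulrA; congr (_ * _).
  transitivity (\sum_(s in S) F' (force (r e) (t (r e)) s)).
    by apply: eq_bigl => s; rewrite [in RHS]finset.in_set.
  rewrite (sum_force _ _ S V2).
  + congr (_ * _); apply: eq_bigl => s.
    by rewrite [in LHS]finset.in_set [in RHS]finset.in_set andbA.
  + move=> s c; rewrite finset.in_set => /andP[sP /eqP sl].
    rewrite finset.in_set => /andP[/eqP cb ca].
    rewrite finset.in_set deck_perms_swap//= permM sl tpermD//.
  + move=> s; rewrite finset.in_set => /andP[/deck_permsP sP /eqP sl].
    rewrite finset.in_set -sP -sl (inj_eq perm_inj) [r e == _]eq_sym lr andbT.
    by move/deck_permsP: tP => <-.
- move=> s c sP; rewrite finset.in_set => /eqP cb; exact: deck_perms_swap.
- move=> s /deck_permsP sP; rewrite finset.in_set -sP.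
  by move/deck_permsP: tP => <-.
Qed.

(** The sum over [t] of the averages over the set of permutations agreeing with
    [t] at [e] is the sum over [t] itself, and a descent at [e] depends on those
    two values only. *)
Lemma impose_size_bias (F : 'S_n -> R) :
  \sum_(s in Pi) \sum_j impose_weight j * F (impose j.1 j.2 s) =
  \sum_(s in Pi) descents s * F s.
Proof.
rewrite exchange_big /=.
under [RHS]eq_bigr do rewrite mulr_suml.
rewrite [RHS]exchange_big /=.
rewrite -(pair_big_dep xpredT (fun _ _ => true)
  (fun e t => \sum_(s in Pi) impose_weight (e, t) * F (impose e t s))) /=.
apply: eq_bigr => e _.
transitivity (\sum_(t in Pi) \sum_(s in agree e t)
   ((descent_at e t)%:R / #|agree e t|%:R * F s)).
  rewrite [RHS]big_mkcond /=; apply: eq_bigr => t _.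
  rewrite -mulr_sumr -mulr_sumr /impose_weight /=.
  have [tP|] := boolP (t \in Pi); last by rewrite mul0r mul0r.
  have a0 : #|agree e t|%:R != 0 :> R.
    rewrite pnatr_eq0 -lt0n; apply/card_gt0P; exists t; exact/agreeP.
  have P0 : #|Pi|%:R != 0 :> R.
    by rewrite pnatr_eq0 -lt0n; apply/card_gt0P; exists t.
  rewrite andTb -(mulfK a0 (\sum_(s in Pi) F (impose e t s))) sum_impose//.
  by field; rewrite a0 P0.
rewrite (exchange_big_dep (mem Pi)) /=; last by move=> t s _ /agreeP[].
apply: eq_bigr => s sP.
have a0 : #|agree e s|%:R != 0 :> R.
  rewrite pnatr_eq0 -lt0n; apply/card_gt0P; exists s; exact/agreeP.
rewrite (eq_bigl (mem (agree e s))); last first.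
  move=> t /=; apply/andP/agreeP.
    by move=> [tP /agreeP[_ -> ->]].
  by move=> [tP h1 h2]; split => //; apply/agreeP.
rewrite (eq_bigr (fun=> (descent_at e s)%:R / #|agree e s|%:R * F s)).
  by rewrite sumr_const -[_ *+ #|_|]mulr_natr; field.
move=> t /agreeP[tP h1 h2]; congr (_%:R / _%:R * _).
  by rewrite /descent_at h1 h2.
apply: eq_card => s'; apply/agreeP/agreeP => -[-> -> ->]; rewrite ?h1 ?h2; split => //.
Qed.

Definition mean_shift s : R :=
  \sum_j impose_weight j * (descents (impose j.1 j.2 s) - descents s).

(** A summand changes, and then by at most [16 = 2 * 8], only if one of the four
    values [s (l e)], [s (r e)], [t (l e)], [t (r e)] is one of the at most six
    values adjacent to [c] and [c'].  For each [t] there are at most 12 such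
    incidences for [s] and as many for [t], and [384 = 16 * (12 + 12)]. *)
Lemma mean_shift_tperm s c c' :
  s \in Pi -> `|mean_shift (s * tperm c c')%g - mean_shift s| <= 384.
Proof.
move=> sP.
have P0 : 0 < #|Pi|%:R :> R by rewrite ltr0n; apply/card_gt0P; exists s.
set B := adjacent_values s [set c; c']%SET.
have cB : #|B|%:R <= 6 :> R.
  rewrite (ler_nat R _ 6) (leq_trans (card_adjacent_values _ _))//.
  have : (#|[set c; c']%SET| <= 2)%N by rewrite cards2 ltnS leq_b1.
  by rewrite -(leq_pmul2l (isT : (0 < 3)%N)).
pose hit e t : R := (t (l e) \in B)%:R + (t (r e) \in B)%:R.
rewrite /mean_shift -sumrB (le_trans (ler_norm_sum _ _ _))//.
apply: (@le_trans _ _ (\sum_(j : E * 'S_n) (j.2 \in Pi)%:R / #|Pi|%:R *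
     (16 * (hit j.1 s + hit j.1 j.2)))).
  apply: ler_sum => -[e t] _ /=.
  rewrite -mulrBr normrM (ger0_norm (impose_weight_ge0 _)).
  apply: ler_pM => //; first exact: impose_weight_ge0.
    rewrite ler_pM2r ?invr_gt0// ler_nat /=.
    by case: (t \in Pi); rewrite ?leq_b1.
  have bnd : `|descents (impose e t (s * tperm c c')%g) - descents (s * tperm c c')%g -
       (descents (impose e t s) - descents s)| <= 16.
    have := descents_impose e t s.
    have := descents_impose e t (s * tperm c c')%g.
    rewrite !ler_norml; lra.
  rewrite /hit.
  have b0 (b : bool) : 0 <= b%:R :> R by case: b.
  have [h1|h1] := boolP (s (l e) \in B).
    move: bnd (b0 (s (r e) \in B)) (b0 (t (l e) \in B)) (b0 (t (r e) \in B)) => /=; lra.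
  have [h2|h2] := boolP (s (r e) \in B).
    move: bnd (b0 (t (l e) \in B)) (b0 (t (r e) \in B)) => /=; lra.
  have [h3|h3] := boolP (t (l e) \in B).
    move: bnd (b0 (t (r e) \in B)) => /=; lra.
  have [h4|h4] := boolP (t (r e) \in B); first by move: bnd => /=; lra.
  rewrite (impose_local _ _ _ _ [set c; c']%SET)//; last exact: tperm_out.
  by rewrite subrr normr0 !addr0 mulr0.
rewrite -(pair_big_dep xpredT (fun _ _ => true)
  (fun e t => (t \in Pi)%:R / #|Pi|%:R * (16 * (hit e s + hit e t)))) /=.
rewrite exchange_big /=.
apply: (@le_trans _ _ (\sum_(t in Pi) 384 / #|Pi|%:R)).
  rewrite [leRHS]big_mkcond /=; apply: ler_sum => t _.
  rewrite -mulr_sumr; case: ifP => tP; last by rewrite mul0r mul0r.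
  rewrite mul1r mulrC ler_pM2r ?invr_gt0// -mulr_sumr big_split /=.
  have := incident_le s B; have := incident_le t B; rewrite /incident /hit; lra.
by rewrite sumr_const -[_ *+ _]mulr_natr divfK// gt_eqF.
Qed.

End Deck.
End Descents.

(** * The normal approximation of the number of descents *)

Lemma des_descents (R : realType) m (s : 'S_m.+1) :
  (des s)%:R = descents R m.+1 'I_m (widen_ord (leqnSn m)) (lift ord0) s.
Proof.
rewrite /descents -natr_sum; congr _%:R; rewrite /des -sum1_card big_mkcond /=.
rewrite big_ord_recr /= [X in (_ + X)%N](_ : _ = 0%N) ?addn0; last first.
  rewrite finset.in_set; case: existsP => // -[j /andP[/eqP jm _]].
  by have := ltn_ord j; rewrite jm ltnn.
apply: eq_bigr => e _; rewrite finset.in_set /descent_at.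
have -> : [exists j : 'I_m.+1, (j == (widen_ord (leqnSn m) e).+1 :> nat) &&
    (s j < s (widen_ord (leqnSn m) e))%N] =
    (s (lift ord0 e) < s (widen_ord (leqnSn m) e))%N.
  apply/existsP/idP => [[j /andP[/eqP je h]]|h]; last first.
    by exists (lift ord0 e); rewrite h andbT lift0.
  by have -> : lift ord0 e = j by apply: val_inj; rewrite /= je.
by case: (_ < _)%N.
Qed.

Theorem theorem6p5 (R : realType) :
  exists C : R, 0 < C /\
  forall (L : eqType) (h n0 n : nat) (D1 D2 : n.-tuple L),
    (1 <= h)%N -> (1 <= n0)%N -> n = (h * n0)%N ->
    size (undup D1) = h ->
    (forall l : L, l \in D1 -> count_mem l D1 = n0) ->
    perm_eq D1 D2 ->
    let Pi := deck_perms D1 D2 in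
    let W := fun s : 'S_n => (des s)%:R : R in
    let mu := unif_mean Pi W in
    let sigma := Num.sqrt (unif_var Pi W) in
    7 `^ (2 / 3) * (6 * mu) `^ (1 / 3) < sigma ->
    forall x : R,
      `| unif_pr R Pi (fun s => (W s - mu) / sigma <= x) - std_normal_cdf x |
      <= C * (1 / sigma + mu / sigma ^+ 3 + mu / sigma ^+ 4
              + Num.sqrt n%:R / sigma ^+ 2).
Proof.
exists 1536; split; first by rewrite ltr0n.
move=> L h n0 n D1 D2 h1 n01 nE _ _ _.
have : (0 < n)%N by rewrite nE muln_gt0 h1.
clear nE; case: n D1 D2 => // m D1 D2 _ Pi W mu sigma hsigma x.
have sigma0 : 0 < sigma by apply: le_lt_trans hsigma; rewrite mulr_ge0 ?powR_ge0.
have l_inj : injective (widen_ord (leqnSn m)).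
  by move=> i j /(congr1 val) /= ?; exact: val_inj.
have r_inj : injective (@lift m.+1 ord0) by exact: lift_inj.
have lr (e : 'I_m) : widen_ord (leqnSn m) e != lift ord0 e.
  by rewrite -val_eqE /= /bump leq0n add1n neq_ltn ltnSn.
have WE : W = descents R m.+1 'I_m (widen_ord (leqnSn m)) (lift ord0).
  by apply/funext => s; exact: des_descents.
have W0 s : s \in Pi -> 0 <= W s by [].
have mu0 : 0 <= mu by apply: unif_mean_ge0.
have key := size_bias_kolmogorov_bound R _ _ Pi W
  (impose_weight R m.+1 'I_m (widen_ord (leqnSn m)) (lift ord0) L D1 D2)
  (fun j s => impose m.+1 'I_m (widen_ord (leqnSn m)) (lift ord0) j.1 j.2 s)
  8 (m.+1%:R * 384 ^+ 2) sigma0.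
have {}key := key (impose_weight_ge0 _ _ _ _ _ _ _ _).
have : `|unif_pr R Pi (fun s => (W s - mu) / sigma <= x) - std_normal_cdf x| <=
  4 * (Num.sqrt (m.+1%:R * 384 ^+ 2) / sigma ^+ 2) +
  24 * (mu / sigma * (8 / sigma) ^+ 2) + 4 * (8 / sigma).
  apply: key => //.
  - move=> f; rewrite /unif_mean; congr (_ / _); rewrite WE.
    exact: (impose_size_bias _ _ _ _ _ lr _ _ _ (fun s => f (descents _ _ _ _ _ s))).
  - by move=> j s _; rewrite WE; exact: descents_impose.
  - apply: deck_unif_var_le => s c c' sP _; rewrite WE.
    exact: mean_shift_tperm.
move/le_trans; apply.
rewrite sqrtrM// sqrtr_sqr ger0_norm//.
have sg0 := ltW sigma0.
have m4 : 0 <= mu / sigma ^+ 4 by rewrite divr_ge0 ?exprn_ge0.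
have i0 : 0 <= 1 / sigma by rewrite divr_ge0.
rewrite [X in X <= _](_ : _ = 1536 * (Num.sqrt m.+1%:R / sigma ^+ 2) +
    1536 * (mu / sigma ^+ 3) + 32 * (1 / sigma)); last first.
  by field; rewrite gt_eqF.
lra.
Qed.
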